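(* Let $(\mathcal{Y},d)$ be a complete unbounded length space and let $u:\mathcal{Y}\to\mathbb{R}$ be a continuous function. Then the following statements are equivalent: (i) $u$ is a metric viscosity solution (on $\Omega=\mathcal{Y}$); (ii) $u$ is a dl$_G$-function on $\mathcal{Y}$; (iii) for any $y\in\mathcal{Y}$ and any $r>0$, $$u(y)=\inf_{x\in\partial B_r(y)}\{u(x)+d(x,y)\},$$ where $\partial B_r(y)$ is the sphere centered at $y$ with radius $r$.
   Context: A length space is a metric space in which the distance between any two points equals the infimum of the lengths of the rectifiable curves joining them. $\partial B_r(y)=\{x\in\mathcal{Y}: d(x,y)=r\}$. Metric viscosity solution: for an open set $\Omega\subset\mathcal{Y}$ and $u:\Omega\to\mathbb{R}$, the local slope at $y\in\Omega$ is $|\partial u|(y)=\limsup_{x\in\Omega,\,x\to y}\frac{(u(y)-u(x))^+}{d(y,x)}$. A locally Lipschitz function $u:\Omega\to\mathbb{R}$ is a metric viscosity solution (of the eikonal equation $|\nabla u|=1$ in $\Omega$) if $|\partial u|(y)=1$ for every $y\in\Omega$. dl$_G$-function: a function $u:\mathcal{Y}\to\mathbb{R}$ on an unbounded metric space is a dl$_G$-function if for each $y\in\mathcal{Y}$, $u(y)=c+d(y,u^{-1}(-\infty,c])$ for all $c<u(y)$, with the convention $d(y,\emptyset)=\infty$. *)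

(* Defs.v *)
From HB Require Import structures.
From mathcomp Require Import all_boot all_order all_algebra.
From mathcomp Require Import all_classical all_reals all_analysis.

Set Implicit Arguments.
Unset Strict Implicit.
Unset Printing Implicit Defensive.

Import Order.TTheory GRing.Theory Num.Theory.
Import numFieldNormedType.Exports.

Local Open Scope classical_set_scope.
Local Open Scope ring_scope.

#[short(type="completeMetricType")]
HB.structure Definition CompleteMetric (K : numDomainType) :=
  {T of Complete T & Metric K T}.

Section length_spaces.
Context {R : realType} (Y : metricType R).

Definition unbounded_space := forall M : R, exists x y : Y, M < mdist x y.

(* The analogue of [variation] for a metric-valued [f]: the points of the
   partition are [a :: s], with [s] as in [itv_partition a b s]. *)
Definition curve_variation (a b : R) (f : R -> Y) (s : seq R) : R :=
  let F := f \o nth b (a :: s) in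
  \sum_(0 <= n < size s) mdist (F n) (F n.+1).

Definition curve_length (a b : R) (f : R -> Y) : \bar R :=
  ereal_sup [set (curve_variation a b f s)%:E | s in itv_partition a b].

(* A curve is a continuous map on a segment [a, b]; it is represented by a
   function on the whole line whose values outside [a, b] are irrelevant. *)
Definition curve_joining (x y : Y) (a b : R) (f : R -> Y) :=
  [/\ a <= b, {within `[a, b], continuous f}, f a = x & f b = y].

Definition rectifiable (a b : R) (f : R -> Y) := (curve_length a b f < +oo)%E.

(* The infimum over the empty set is +oo, so the equation forces any two points
   to be joined by some rectifiable curve. *)
Definition length_space := forall x y : Y,
  (mdist x y)%:E = ereal_inf [set l | exists a b (f : R -> Y),
    [/\ curve_joining x y a b f, rectifiable a b f & l = curve_length a b f]].

End length_spaces.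

Section eikonal.
Context {R : realType} {Y : metricType R}.

(* A function on an open set [Omega] is represented by a function on [Y] of
   which only the values on [Omega] are used. *)
Definition locally_lipschitz (Omega : set Y) (u : Y -> R) :=
  forall y, Omega y -> exists L : R, exists2 V, nbhs y V &
    forall x z, (Omega `&` V) x -> (Omega `&` V) z ->
      `|u x - u z| <= L * mdist x z.

Definition local_slope (Omega : set Y) (u : Y -> R) (y : Y) : \bar R :=
  limf_esup (fun x => (Num.max (u y - u x) 0 / mdist y x)%:E)
            (within Omega y^').

Definition metric_viscosity_solution (Omega : set Y) (u : Y -> R) :=
  locally_lipschitz Omega u /\
  forall y, Omega y -> local_slope Omega u y = 1%:E.

(* Equal to +oo when [A] is empty. *)
Definition dist_to_set (y : Y) (A : set Y) : \bar R :=
  ereal_inf [set (mdist y x)%:E | x in A].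

Definition dlG_function (u : Y -> R) :=
  forall (y : Y) (c : R), c < u y ->
    (u y)%:E = (c%:E + dist_to_set y (u @^-1` `]-oo, c]))%E.

Definition sphere (y : Y) (r : R) : set Y := [set x | mdist x y = r].

End eikonal.

(* Main.v *)
Require Import Defs.
From HB Require Import structures.
From mathcomp Require Import all_boot all_order all_algebra.
From mathcomp Require Import all_classical all_reals all_analysis.
From mathcomp Require Import lra.

Set Implicit Arguments.
Unset Strict Implicit.
Unset Printing Implicit Defensive.

Import Order.TTheory GRing.Theory Num.Theory.
Import numFieldNormedType.Exports.

Local Open Scope classical_set_scope.
Local Open Scope ring_scope.

(** The three conditions meet in the 1-Lipschitz bound [u y - u x <= d(y, x)]
    together with a descent of [u] at unit rate.  For (i) => (ii), slope at most
    1 gives the Lipschitz bound by following a nearly shortest curve, and slope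
    above [k < 1] gives the descent by Ekeland's variational principle applied
    to [max(u, c)]: an Ekeland point with [u > c] would have slope at most [k].
    For (ii) => (iii), a nearly shortest curve from [y] to [{u <= u y - r}]
    crosses the sphere of radius [r] close to its end.  For (iii) => (i), the
    sphere of radius [d(x, y)] gives the Lipschitz bound, and points nearly
    realizing the infimum on small spheres give slope at least 1. *)

(** * Partitions and nearly shortest curves *)

Lemma curve_variation2 (R : realType) (Y : metricType R) (a b c : R)
    (f : R -> Y) :
  curve_variation a b f [:: c; b] = mdist (f a) (f c) + mdist (f c) (f b).
Proof. by rewrite /curve_variation big_nat_recl// big_nat1. Qed.

Lemma curve_variation_rcons (R : realType) (Y : metricType R) (a b c : R)
    (f : R -> Y) (s : seq R) : last a s = b ->
  curve_variation a c f (rcons s c) =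
  curve_variation a b f s + mdist (f b) (f c).
Proof.
move=> sb; rewrite /curve_variation size_rcons big_nat_recr//=; congr (_ + _).
  apply: eq_big_nat => i /andP[_ si].
  rewrite -rcons_cons !nth_rcons/= !ltnS (ltnW si) si.
  (* The default of [nth] is the right endpoint, so [c] on one side and [b] on the other; all
     indices are in range, where the default is immaterial. *)
  by rewrite (set_nth_default b c)//= ?(set_nth_default b c si) ?ltnS 1?ltnW.
rewrite -rcons_cons !nth_rcons/= ltnSn ltnn eqxx.
by rewrite -sb (last_nth c).
Qed.

Lemma itv_partition_rcons (R : realType) (a b c : R) (s : seq R) :
  itv_partition a b s -> b < c -> itv_partition a c (rcons s c).
Proof.
move=> abs bc; rewrite -cats1.
by apply: itv_partition_cat abs _; exact: itv_partition1.
Qed.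

Lemma length_space_curve (R : realType) (Y : metricType R) :
  length_space Y -> forall (x y : Y) (e : R), 0 < e ->
  exists a b (f : R -> Y), curve_joining x y a b f /\
    forall s, itv_partition a b s -> curve_variation a b f s < mdist x y + e.
Proof.
move=> Ylen x y e e0.
have : (ereal_inf [set l | exists a b (f : R -> Y),
    [/\ curve_joining x y a b f, rectifiable a b f & l = curve_length a b f]] <
    (mdist x y + e)%:E)%E.
  by rewrite -Ylen lte_fin ltrDl.
move=> /ereal_inf_lt[_ [a [b [f [fxy _ ->]]]] fe].
exists a, b, f; split => // s abs; rewrite -lte_fin.
by apply: le_lt_trans fe; apply: ereal_sup_ubound; exists s.
Qed.

Lemma within_itv_nbhs (R : realType) (T : topologicalType) (a b : R)
    (g : R -> T) : {within `[a, b], continuous g} ->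
  forall t, a <= t <= b -> forall V, nbhs (g t) V -> exists2 d, 0 < d &
    forall s, a <= s <= b -> `|t - s| < d -> V (g s).
Proof.
move=> /subspace_continuousP gc t tab V Vgt.
have tI : `[a, b]%classic t by rewrite /= in_itv.
have /nbhs_ballP[d d0 dV] := gc t tI V Vgt.
by exists d => // s sab ts; apply: dV => //=; rewrite in_itv.
Qed.

(** By the intermediate value theorem a nearly shortest curve meets the sphere of radius [r]; the
    two-step partition through that point bounds the rest of the way. *)
Lemma path_intermediate (R : realType) (Y : metricType R) :
  length_space Y -> forall (y x : Y) (r e : R), 0 <= r <= mdist y x -> 0 < e ->
  exists z, mdist y z = r /\ mdist z x < mdist y x - r + e.
Proof.
move=> Ylen y x r e /andP[r0 rd] e0.
have [a [b [f [[ab fc fa fb] fl]]]] := length_space_curve Ylen y x e0.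
have dc : continuous (mdist y).
  move=> p; apply/cvgrPdist_lt => h h0; near=> q.
  have pq : mdist p q < h.
    by near: q; apply: (@metricType_numDomainType.cvgr_dist_lt _ _ _ _ _ id p).
  have := metric_triangle y p q; have := metric_triangle y q p.
  rewrite (metric_sym q p) ltr_norml; lra.
have [||c + fcr] := @IVT R (mdist y \o f) a b r ab.
- by apply: within_continuous_comp => // z _; exact: dc.
- by rewrite /= fa fb mdistxx min_l ?max_r ?mdist_ge0// r0.
rewrite in_itv/= => /andP[]; rewrite !le_eqVlt.
(* Partitions are strictly increasing, so [c = a] and [c = b] are treated apart. *)
move=> /predU1P[ac _|ac /predU1P[cb|cb]].
- by exists y; move: fcr; rewrite /= -ac fa mdistxx => <-; split => //; lra.
- by exists x; move: fcr; rewrite /= cb fb mdistxx => <-; split => //; lra.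
exists (f c); split => //.
have /fl : itv_partition a b [:: c; b] by rewrite /itv_partition/= ac cb.
by rewrite curve_variation2 fa fb -fcr/=; lra.
Unshelve. all: by end_near. Qed.

(** * From local slope bounds to a global Lipschitz bound *)

(** Continuous induction along the curve: continuity of [u \o f] carries the estimate to the
    supremum [T] of the good parameters, and the local bound at [f T] carries it past [T] unless
    [T = b]. *)
Lemma descent_partition (R : realType) (Y : metricType R) (u : Y -> R)
    (a b k : R) (f : R -> Y) : a <= b -> 0 <= k -> continuous u ->
  {within `[a, b], continuous f} ->
  (forall y, \forall x \near y, u y - u x <= k * mdist y x) ->
  forall e, 0 < e -> exists2 s, itv_partition a b s &
    u (f a) - u (f b) <= k * curve_variation a b f s + e.
Proof.
move=> ab k0 uc fc uk.
(* The error [e] is quantified inside [P], so that [P] passes to the supremum. *)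
pose P t := forall e, 0 < e -> exists2 s, itv_partition a t s &
    u (f a) - u (f t) <= k * curve_variation a t f s + e.
pose S := [set t | a <= t <= b /\ P t].
have Sa : S a.
  split; first by rewrite lexx.
  by move=> e e0; exists [::]; [split|rewrite /curve_variation big_nil; lra].
have Sb : has_sup S by split; [exists a|exists b => t [/andP[]]].
set T := sup S.
have aT : a <= T by exact: sup_ubound Sb.2 _ Sa.
have Tb : T <= b by apply: sup_le_ub Sb.1 _ => t [/andP[]].
have PT : P T.
  move=> e e0.
  have ufc : {within `[a, b], continuous (u \o f)}.
    by apply: within_continuous_comp => // z _; exact: uc.
  have e20 : 0 < e / 2 by rewrite divr_gt0.
  have aTb : a <= T <= b by rewrite aT.
  have [d d0 dT] := within_itv_nbhs ufc aTb
    (@nbhsx_ballx _ R^o ((u \o f) T) _ e20).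
  have [t [/andP[at_ tb] Pt] Tt] := sup_adherent d0 Sb.
  (* The bound near [f t] may not reach [f T], so continuity at [T] pays for the last step, at a
     cost of [e / 2]; appending [T] can only increase the variation. *)
  have tT : t <= T by apply: sup_ubound Sb.2 _ _; split => //; rewrite at_.
  have := dT t; rewrite at_ tb => /(_ isT); rewrite ger0_norm ?subr_ge0//.
  rewrite -/T in Tt; rewrite /ball/= => /(_ ltac:(lra)).
  have [s ats us] := Pt _ e20.
  rewrite ltr_norml => /andP[h1 h2].
  move: tT; rewrite le_eqVlt => /predU1P[tT|tT].
    by exists s; rewrite -tT => //; lra.
  exists (rcons s T); first exact: itv_partition_rcons ats tT.
  rewrite (curve_variation_rcons T f (eqP ats.2)) mulrDr.
  have := mulr_ge0 k0 (mdist_ge0 (f t) (f T)); lra.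
move: Tb; rewrite le_eqVlt => /predU1P[Tb|Tb]; first by rewrite -Tb.
exfalso.
have aTb : a <= T <= b by rewrite aT ltW.
have [d d0 dT] := within_itv_nbhs fc aTb (uk (f T)).
pose t := Num.min (T + d / 2) b.
have Tt : T < t by rewrite lt_min Tb andbT; lra.
have tb : t <= b by rewrite ge_min lexx orbT.
have td : t <= T + d / 2 by rewrite ge_min lexx.
have : S t.
  split; first by rewrite tb andbT (le_trans aT) ?ltW.
  move=> e e0; have [s aTs us] := PT _ e0.
  exists (rcons s t); first exact: itv_partition_rcons aTs Tt.
  rewrite (curve_variation_rcons t f (eqP aTs.2)) mulrDr.
  have := dT t; rewrite tb (le_trans aT (ltW Tt)) => /(_ isT).
  rewrite ltr0_norm ?subr_lt0// => /(_ ltac:(lra)); lra.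
by move=> /(sup_ubound Sb.2); rewrite leNgt Tt.
Qed.

Lemma locally_le_lipschitz1 (R : realType) (Y : metricType R) (u : Y -> R) :
  length_space Y -> continuous u ->
  (forall k, 1 < k -> forall y, \forall x \near y, u y - u x <= k * mdist y x) ->
  forall y x, u y - u x <= mdist y x.
Proof.
move=> Ylen uc uk y x; apply/ler_addgt0Pl => e e0.
(* One [m] bounds the excess of the slope, the excess length and the partition error. With
   [D = mdist y x] the total error is [m * (D + 2 + m)], at most [m * (D + 3) <= e] since
   [m <= 1]. *)
pose h := e / (mdist y x + 3).
have d0 := mdist_ge0 y x.
have h0 : 0 < h by rewrite divr_gt0//; lra.
pose m := Num.min h 1.
have m0 : 0 < m by rewrite lt_min h0 ltr01.
have m1 : m <= 1 by rewrite ge_min lexx orbT.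
have [a [b [f [[ab fc fa fb] fl]]]] := length_space_curve Ylen y x m0.
have k1 : 1 < 1 + m by rewrite ltrDl.
have [s abs us] :=
  descent_partition ab (le_trans ler01 (ltW k1)) uc fc (uk _ k1) m0.
have := fl _ abs; rewrite fa fb in us => ls.
have : (1 + m) * curve_variation a b f s <= (1 + m) * (mdist y x + m).
  by rewrite ler_pM2l ?ltW// (lt_trans ltr01).
have : m * (mdist y x + 3) <= e.
  by rewrite -ler_pdivlMr ?ge_min ?lexx//; lra.
have : m * m <= m * 1 by rewrite ler_pM2l.
nra.
Qed.

(** * Ekeland's variational principle *)

(** The sets [S z] decrease along a sequence that nearly minimizes [v] on each of them; its limit
    [z] lies in all of them, and [S z] is reduced to [z]. *)
Lemma ekeland (R : realType) (Y : completeMetricType R) (v : Y -> R)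
    (c k : R) : continuous v -> (forall x, c <= v x) -> 0 < k ->
  forall y, exists z, v z + k * mdist y z <= v y /\
    forall x, x != z -> v z < v x + k * mdist z x.
Proof.
move=> vc cv k0 y.
pose S z := [set x | v x + k * mdist z x <= v z].
have Szz z : S z z by rewrite /S/= mdistxx mulr0 addr0.
have Strans z w x : S z w -> S w x -> S z x.
  rewrite /S/= => zw wx; have := metric_triangle z w x.
  by rewrite -(ler_pM2l k0) mulrDr; lra.
(* [w] at least halves the gap between [v z] and the infimum of [v] on [S z]. *)
have step z : {w | S z w /\ forall x, S z x -> 2 * v w <= v z + v x}.
  apply: cid; pose I := inf [set v x | x in S z].
  have Ib : has_inf [set v x | x in S z].
    by split; [exists (v z), z|exists c => _ [x _ <-]].
  have Ile x : S z x -> I <= v x by move=> Sx; apply: inf_lbound Ib.2 _ _; exists x.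
  have := Ile _ (Szz z); rewrite le_eqVlt => /predU1P[Iz|Iz].
    by exists z; split => // x /Ile; lra.
  have [|_ [w Sw <-] wI] := @inf_adherent _ _ ((v z - I) / 2) _ Ib.
    by rewrite divr_gt0// subr_gt0.
  by exists w; split => // x /Ile; rewrite -/I in wI; lra.
have [w_ [w0 wS]] := dependent_choice step y.
have Sw n m : (n <= m)%N -> S (w_ n) (w_ m).
  elim: m => [|m ih]; first by rewrite leqn0 => /eqP ->.
  rewrite leq_eqVlt => /predU1P[->//|/ih nm]; exact: Strans nm (wS m).1.
have vn : nonincreasing_seq (v \o w_).
  move=> n m /Sw; rewrite /S/=.
  have := mulr_ge0 (ltW k0) (mdist_ge0 (w_ n) (w_ m)); lra.
have vcvg : cvgn (v \o w_).
  by apply: nonincreasing_is_cvgn => //; exists c => _ [n _ <-]; exact: cv.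
(* Membership in [S] bounds [k] times the distance by the drop of [v], and these drops tend to 0. *)
have /(@cauchy_cvg _ _ _) wcvg : cauchy (w_ @ \oo).
  apply/cauchy_exP => e e0.
  have ke0 : 0 < k * e by rewrite mulr_gt0.
  have [N _ NP] := cvgr_lt _ vcvg (limn (v \o w_) + k * e)
    (ltac:(by rewrite ltrDl)).
  exists (w_ N); exists N => // m Nm; rewrite /= ballEmdist/=.
  have := NP N (leqnn N); have := Sw _ _ Nm; rewrite /S/= => h1 h2.
  have := nonincreasing_cvgn_ge vn vcvg m => /= h3.
  by rewrite -(ltr_pM2l k0); lra.
set z := lim (w_ @ \oo) in wcvg.
have vz : v (w_ n) @[n --> \oo] --> v z.
  exact: (continuous_cvg _ (vc z) wcvg).
have Sz n : S (w_ n) z.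
  rewrite /S/=; apply/ler_addgt0Pl => e e0.
  have e20 : 0 < e / 2 by rewrite divr_gt0.
  have h1 : \forall m \near \oo, mdist z (w_ m) < e / 2 / k.
    by apply: metricType_numDomainType.cvgr_dist_lt => //; rewrite divr_gt0.
  have h2 : \forall m \near \oo, `|v z - v (w_ m)| < e / 2.
    exact: cvgr_dist_lt vz _ e20.
  near \oo => m.
  have d1 : mdist z (w_ m) < e / 2 / k by near: m.
  have d2 : `|v z - v (w_ m)| < e / 2 by near: m.
  have nm : (n <= m)%N by near: m; exact: nbhs_infty_ge.
  have := Sw _ _ nm; rewrite /S/=.
  have := metric_triangle (w_ n) (w_ m) z; rewrite -(ler_pM2l k0) mulrDr.
  move: d1; rewrite (metric_sym z) ltr_pdivlMr// mulrC.
  by move: d2; rewrite ltr_norml; lra.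
exists z; split; first by have := Sz 0%N; rewrite w0.
move=> x xz; rewrite ltNge; apply/negP => Szx.
(* Such an [x] lies in every [S (w_ n)], so the halving inequality tends to
   [2 * v z <= v z + v x]. *)
have vzx : v z <= v x.
  have h n : 2 * v (w_ n.+1) <= v (w_ n) + v x.
    by apply: (wS n).2; exact: Strans (Sz n) Szx.
  apply/ler_addgt0Pl => e e0.
  have e40 : 0 < e / 4 by rewrite divr_gt0.
  have [N _ NP] := cvgr_dist_lt _ _ vz _ e40.
  have := NP N (leqnn N); have := NP N.+1 (leqnSn N); have := h N.
  by rewrite /= !ltr_norml; lra.
have : 0 < k * mdist z x by rewrite mulr_gt0// mdist_gt0 eq_sym.
by move: Szx; lra.
Unshelve. all: by end_near. Qed.

(** * Local slope and descent *)

Lemma local_slope_lt (R : realType) (Y : metricType R) (u : Y -> R) (y : Y)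
    (k : R) : (local_slope [set: Y] u y < k%:E)%E ->
  \forall x \near y, u y - u x <= k * mdist y x.
Proof.
rewrite /local_slope withinET => /ereal_inf_lt[_ [V Vy <-]] Vk.
have : \forall x \near y, x != y -> V x by [].
apply: filterS => x Vx.
have [->|xy] := eqVneq x y; first by rewrite subrr mdistxx mulr0.
have d0 : 0 < mdist y x by rewrite mdist_gt0 eq_sym.
have : ((Num.max (u y - u x) 0 / mdist y x)%:E <= k%:E)%E.
  apply: le_trans (ltW Vk); apply: ereal_sup_ubound.
  by exists x => //; exact: Vx.
rewrite lee_fin ler_pdivrMr//; apply: le_trans.
by rewrite le_max lexx.
Qed.

Lemma local_slope_gt (R : realType) (Y : metricType R) (u : Y -> R) (y : Y)
    (k : R) : 0 <= k -> (k%:E < local_slope [set: Y] u y)%E ->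
  forall V, nbhs y V -> exists2 x, V x & x != y /\ k * mdist y x < u y - u x.
Proof.
move=> k0; rewrite /local_slope withinET// => ku V Vy.
pose W := [set x | V x /\ x != y].
have Wy : y^' W by rewrite /dnbhs/within/=; apply: filterS Vy => x.
have : (k%:E < ereal_sup
    ((fun x => (Num.max (u y - u x) 0 / mdist y x)%:E) @` W))%E.
  by apply: lt_le_trans ku _; apply: ereal_inf_lbound; exists W.
move=> /ereal_sup_gt[_ [x [Vx xy] <-]]; rewrite lte_fin.
have d0 : 0 < mdist y x by rewrite mdist_gt0 eq_sym.
(* As [0 <= k], the maximum exceeding [k * mdist y x] cannot be its zero term. *)
rewrite ltr_pdivlMr// lt_max => /orP[kd|]; first by exists x.
by rewrite ltNge mulr_ge0// ltW.
Qed.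

(** Truncation at [c] supplies the lower bound for Ekeland's principle and leaves [u] unchanged near
    any point where [u > c]. *)
Lemma slope_descent (R : realType) (Y : completeMetricType R) (u : Y -> R)
    (c k : R) : continuous u -> 0 < k ->
  (forall y, (k%:E < local_slope [set: Y] u y)%E) ->
  forall y, c <= u y -> exists2 z, u z <= c & k * mdist y z <= u y - c.
Proof.
move=> uc k0 uk y cy.
pose v x := Num.max (u x) c.
have vc : continuous v.
  by move=> x; apply: continuous_max; [exact: uc|exact: cvg_cst].
have cv x : c <= v x by rewrite le_max lexx orbT.
have [z [vzy zmin]] := ekeland vc cv k0 y.
have {}vzy : v z + k * mdist y z <= u y by move: vzy; rewrite /v (max_l cy).
exists z; last by have := cv z; lra.
rewrite leNgt; apply/negP => cz.
have cnear : \forall x \near z, c < u x by exact: cvgr_gt (uc z) _ cz.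
have [x cx [xz kx]] := local_slope_gt (ltW k0) (uk z) cnear.
by have := zmin x xz; rewrite /v !max_l ?ltW//; lra.
Qed.

(** * The three implications *)

(** At level [c = u x] the sublevel set contains [x] itself. *)
Lemma dlG_lipschitz1 (R : realType) (Y : metricType R) (u : Y -> R) :
  dlG_function u -> forall y x, u y - u x <= mdist y x.
Proof.
move=> ud y x; have [yx|xy] := leP (u y) (u x).
  by apply: le_trans (mdist_ge0 _ _); rewrite subr_le0.
rewrite lerBlDl -lee_fin (ud _ _ xy) EFinD leeD2l//.
by apply: ereal_inf_lbound; exists x => //=; rewrite in_itv/=.
Qed.

Lemma viscosity_dlG (R : realType) (Y : completeMetricType R) (u : Y -> R) :
  length_space Y -> continuous u ->
  metric_viscosity_solution [set: Y] u -> dlG_function u.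
Proof.
move=> Ylen uc [_ uslope] y c cy.
have lip : forall y x, u y - u x <= mdist y x.
  apply: locally_le_lipschitz1 => // k k1 z; apply: local_slope_lt.
  by rewrite uslope// lte_fin.
suff -> : dist_to_set y (u @^-1` `]-oo, c]) = (u y - c)%:E.
  by rewrite -EFinD subrKC.
apply/eqP; rewrite eq_le; apply/andP; split; last first.
  apply: le_ereal_inf_tmp => _ [x /= + <-]; rewrite in_itv/= lee_fin => xc.
  by have := lip y x; lra.
apply/lee_addgt0Pr => e e0.
have D0 : 0 < u y - c + e by lra.
(* Chosen so that [(u y - c) / k = u y - c + e]. *)
pose k := (u y - c) / (u y - c + e).
have k0 : 0 < k by rewrite divr_gt0// subr_gt0.
have k1 : k < 1 by rewrite ltr_pdivrMr// mul1r; lra.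
have uk z : (k%:E < local_slope [set: Y] u z)%E by rewrite uslope// lte_fin.
have [z zc kz] := slope_descent uc k0 uk (ltW cy).
apply: (@le_trans _ _ (mdist y z)%:E).
  by apply: ereal_inf_lbound; exists z => //=; rewrite in_itv.
rewrite -EFinD lee_fin -(ler_pM2l k0); apply: le_trans kz _.
by rewrite /k mulrVK// unitfE gt_eqF.
Qed.

Lemma dlG_sphere (R : realType) (Y : metricType R) (u : Y -> R) :
  length_space Y -> dlG_function u -> forall (y : Y) (r : R), 0 < r ->
    (u y)%:E = ereal_inf [set (u x + mdist x y)%:E | x in sphere y r].
Proof.
move=> Ylen ud y r r0; have lip := dlG_lipschitz1 ud.
apply/eqP; rewrite eq_le; apply/andP; split.
  apply: le_ereal_inf_tmp => _ [x _ <-]; rewrite lee_fin.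
  by have := lip y x; rewrite (metric_sym y); lra.
apply/lee_addgt0Pr => e e0; have e20 : 0 < e / 2 by rewrite divr_gt0.
have ury : u y - r < u y by lra.
(* The equation at level [u y - r] has a finite left side, so the distance is finite and equals
   [r]. *)
have dr : dist_to_set y (u @^-1` `]-oo, u y - r]) = r%:E.
  have := ud _ _ ury; case: (dist_to_set _ _) => //= s.
  by rewrite -EFinD => -[us]; congr (_%:E); lra.
have : (dist_to_set y (u @^-1` `]-oo, (u y - r)%R]) < (r + e / 2)%:E)%E.
  by rewrite dr lte_fin ltrDl.
move=> /ereal_inf_lt[_ [x /= + <-]]; rewrite in_itv/= lte_fin => ux xr.
have rx : r <= mdist y x by have := lip y x; lra.
have rI : 0 <= r <= mdist y x by rewrite ltW.
have [z [yz zx]] := path_intermediate Ylen rI e20.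
apply: (@le_trans _ _ (u z + mdist z y)%:E).
  by apply: ereal_inf_lbound; exists z => //; rewrite /sphere/= metric_sym.
rewrite -EFinD lee_fin (metric_sym z) yz.
(* Here [mdist z x < e], hence [u z <= u x + e <= u y - r + e]. *)
by have := lip z x; lra.
Qed.

Lemma sphere_viscosity (R : realType) (Y : metricType R) (u : Y -> R) :
  (forall (y : Y) (r : R), 0 < r ->
    (u y)%:E = ereal_inf [set (u x + mdist x y)%:E | x in sphere y r]) ->
  metric_viscosity_solution [set: Y] u.
Proof.
move=> us.
have lip y x : u y - u x <= mdist y x.
  have [->|xy] := eqVneq x y; first by rewrite subrr mdistxx.
  have d0 : 0 < mdist x y by rewrite mdist_gt0.
  have : ((u y)%:E <= (u x + mdist x y)%:E)%E.
    by rewrite (us y _ d0); apply: ereal_inf_lbound; exists x.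
  by rewrite lee_fin (metric_sym y); lra.
split=> [y _|y _].
  exists 1, setT; first exact: filterT.
  move=> x z _ _; rewrite mul1r ler_norml.
  by have := lip x z; have := lip z x; rewrite (metric_sym z); lra.
rewrite /local_slope withinET; apply/eqP; rewrite eq_le; apply/andP; split.
  (* For the upper bound the whole punctured space serves as neighbourhood, since the Lipschitz
     bound is global. *)
  apply: (@le_trans _ _ (ereal_sup ((fun x =>
      (Num.max (u y - u x) 0 / mdist y x)%:E) @` [set x | x != y]))).
    apply: ereal_inf_lbound; exists [set x | x != y] => //.
    by rewrite /dnbhs/within/=; exact: filterE.
  apply: ge_ereal_sup => _ [x /= xy <-]; rewrite lee_fin.
  have d0 : 0 < mdist y x by rewrite mdist_gt0 eq_sym.
  by rewrite ler_pdivrMr// mul1r ge_max lip mdist_ge0.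
apply: le_ereal_inf_tmp => _ [V Vy <-].
apply/lee_addgt0Pr => e e0.
have := Vy; rewrite /dnbhs/within/= => /nbhs_ballP[d d0 dV].
have r0 : 0 < d / 2 by rewrite divr_gt0.
(* The tolerance becomes [e] once divided by the radius [d / 2], which keeps the sphere inside the
   ball of radius [d]. *)
have re0 : 0 < d / 2 * e by rewrite mulr_gt0.
have : (ereal_inf [set (u x + mdist x y)%:E | x in sphere y (d / 2)%R] <
    (u y + d / 2 * e)%:E)%E by rewrite -us// lte_fin ltrDl.
move=> /ereal_inf_lt[_ [x xr <-]]; rewrite /sphere/= in xr.
rewrite xr lte_fin => ux.
have yx : mdist y x = d / 2 by rewrite metric_sym.
have Vx : V x.
  apply: dV; first by rewrite ballEmdist/= yx; lra.
  by rewrite eq_sym -mdist_gt0 yx.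
apply: (@le_trans _ _ ((Num.max (u y - u x) 0 / mdist y x)%:E + e%:E)%E).
  rewrite -EFinD lee_fin yx -lerBlDr ler_pdivlMr// le_max.
  by apply/orP; left; lra.
by rewrite leeD2r//; apply: ereal_sup_ubound; exists x.
Qed.

Theorem theorem1p5 (R : realType) (Y : completeMetricType R)
    (Yunbounded : unbounded_space Y) (Ylength : length_space Y)
    (u : Y -> R) (ucont : continuous u) :
  [<-> metric_viscosity_solution [set: Y] u;
       dlG_function u;
       forall (y : Y) (r : R), 0 < r ->
         (u y)%:E = ereal_inf [set (u x + mdist x y)%:E | x in sphere y r] ].
Proof.
tfae.
- exact: viscosity_dlG.
- exact: dlG_sphere.
- exact: sphere_viscosity.
Qed.
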